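(* The positivity domain $\Delta=\{(0,0),(0,\pm1),(\pm1,0)\}\subseteq\mathbb{Z}^2$ does not possess the complete factorisation property.
   Context: A positivity domain in a discrete group $\Gamma$ is a subset $\Delta\subseteq\Gamma$ with $e\in\Delta$ and $\Delta^{-1}=\Delta$. $\mathrm{C}^*(\Gamma)$ is the universal group C$^*$-algebra with canonical unitaries $\delta_s$, $s\in\Gamma$ (here $\Gamma=\mathbb{Z}^2$, written additively, so $\Sigma\Sigma^{-1}$ means $\Sigma-\Sigma$). $\Delta$ possesses the complete factorisation property if for every $n\in\mathbb{N}$, every $z\in \mathrm{M}_n(\mathrm{C}^*(\Gamma))^+$ with finite support inside $\Delta$ (i.e. $z=\sum_{s\in\Delta}A_s\otimes\delta_s$, a finite sum with $A_s\in \mathrm{M}_n(\mathbb{C})$) and every $\epsilon>0$, there are $r\in\mathbb{N}$, finite sets $\Sigma_i\subseteq\Gamma$ with $\Sigma_i\Sigma_i^{-1}\subseteq\Delta$, and elements $y_i=\sum_{s\in\Sigma_i}B^i_s\otimes\delta_s$, $B^i_s\in \mathrm{M}_n(\mathbb{C})$, $i=1,\dots,r$, such that $z+\epsilon\,\mathbf 1_n\otimes\delta_e=\sum_{i=1}^r y_iy_i^*$. *)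

(* Defs.v *)
From HB Require Import structures.
From mathcomp Require Import all_boot all_order all_algebra finmap.
From mathcomp Require Import boolp classical_sets reals complex.

Set Implicit Arguments.
Unset Strict Implicit.
Unset Printing Implicit Defensive.

Import Order.TTheory GRing.Theory Num.Theory.
Import Normc.

Local Open Scope classical_set_scope.
Local Open Scope ring_scope.
Local Open Scope complex_scope.

(* Unital complex C*-algebras. NormedModule cannot be joined with the ring
   hierarchy (NumDomain already inherits from both and is closed), so the norm
   is a separate real-valued operation. *)
HB.mixin Record isCStarAlgebra (R : realType) A of GRing.Algebra R[i] A := {
  star : A -> A;
  starK : forall a, star (star a) = a;
  starD : forall a b, star (a + b) = star a + star b;
  starZ : forall (k : R[i]) a, star (k *: a) = k^* *: star a;
  starM : forall a b, star (a * b) = star b * star a;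
  cnorm : A -> R;
  cnorm_eq0 : forall a, cnorm a = 0 -> a = 0;
  cnormD : forall a b, cnorm (a + b) <= cnorm a + cnorm b;
  cnormZ : forall (k : R[i]) a, cnorm (k *: a) = normc k * cnorm a;
  cnormM : forall a b, cnorm (a * b) <= cnorm a * cnorm b;
  cnorm_star : forall a, cnorm (star a * a) = cnorm a ^+ 2;
  cnorm_complete : forall u : nat -> A,
    (forall e : R, 0 < e -> exists N : nat, forall m n : nat,
        (N <= m)%N -> (N <= n)%N -> cnorm (u m - u n) < e) ->
    exists l : A, forall e : R, 0 < e -> exists N : nat, forall n : nat,
        (N <= n)%N -> cnorm (u n - l) < e
}.

#[short(type="cstarAlgType")]
HB.structure Definition CStarAlgebra (R : realType) :=
  { A of GRing.Algebra R[i] A & isCStarAlgebra R A }.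

Section GroupCStarAlgebra.
Variables (R : realType) (G : groupType).

Definition unitary_rep (B : cstarAlgType R) (u : G -> B) : Prop :=
  (forall s t, u (s * t)%g = u s * u t) /\
  (forall s, star (u s) * u s = 1 /\ u s * star (u s) = 1).

Definition star_morphism (A B : cstarAlgType R) (phi : {lrmorphism A -> B}) :
  Prop := forall a, phi (star a) = star (phi a).

(* A, with the unitaries delta s, is the universal group C*-algebra of G;
   this determines (A, delta) up to a unique *-isomorphism. *)
Definition universal_group_cstar (A : cstarAlgType R) (delta : G -> A) : Prop :=
  unitary_rep delta /\
  forall (B : cstarAlgType R) (u : G -> B), unitary_rep u ->
    exists phi : {lrmorphism A -> B},
      [/\ star_morphism phi,
          forall s, phi (delta s) = u s
        & forall psi : {lrmorphism A -> B}, star_morphism psi ->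
            (forall s, psi (delta s) = u s) -> psi =1 phi].

End GroupCStarAlgebra.

Section MatrixAlgebra.
Variables (R : realType) (A : cstarAlgType R) (n : nat).

Definition mxstar (z : 'M[A]_n) : 'M[A]_n := (map_mx star z)^T.

Definition mxspectrum (z : 'M[A]_n) : set R[i] :=
  [set l | ~ exists w : 'M[A]_n,
     w *m (z - (l%:A)%:M) = 1%:M /\ (z - (l%:A)%:M) *m w = 1%:M].

(* 0 <= l in R[i] means that l is real and nonnegative. *)
Definition mxpositive (z : 'M[A]_n) : Prop :=
  mxstar z = z /\ (forall l : R[i], mxspectrum z l -> 0 <= l).

(* The elementary tensor M (x) a, under M_n(C) (x) A = M_n(A). *)
Definition mxtensor (M : 'M[R[i]]_n) (a : A) : 'M[A]_n :=
  \matrix_(i, j) (M i j *: a).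

Definition trigsum (G : groupType) (delta : G -> A) (S : {fset G})
    (M : G -> 'M[R[i]]_n) : 'M[A]_n :=
  \sum_(s <- S) mxtensor (M s) (delta s).

End MatrixAlgebra.

Definition positivity_domain (G : groupType) (D : set G) : Prop :=
  D 1%g /\ [set s^-1%g | s in D] = D.

Definition complete_factorisation (R : realType) (G : groupType)
    (A : cstarAlgType R) (delta : G -> A) (D : set G) : Prop :=
  forall (n : nat) (z : 'M[A]_n),
    mxpositive z ->
    (exists (S : {fset G}) (M : G -> 'M[R[i]]_n),
        (forall s, s \in S -> D s) /\ z = trigsum delta S M) ->
  forall eps : R, 0 < eps ->
  exists (r : nat) (S : 'I_r -> {fset G}) (N : 'I_r -> G -> 'M[R[i]]_n),
    (forall i s t, s \in S i -> t \in S i -> D (s * t^-1)%g) /\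
    z + mxtensor (eps%:C *: 1%:M) (delta 1%g) =
      \sum_(i < r) trigsum delta (S i) (N i)
                     *m mxstar (trigsum delta (S i) (N i)).

(* The additive group Z^2, in the multiplicative notation of groupType. *)
Definition Z2 : Type := (int * int)%type.

HB.instance Definition _ := Choice.on Z2.

Definition Z2_mul (s t : Z2) : Z2 := (s.1 + t.1, s.2 + t.2).
Definition Z2_one : Z2 := (0, 0).
Definition Z2_inv (s : Z2) : Z2 := (- s.1, - s.2).

Lemma Z2_mulA : associative Z2_mul.
Proof. by move=> s t v; rewrite /Z2_mul /= !addrA. Qed.

Lemma Z2_mul1 : left_id Z2_one Z2_mul.
Proof. by case=> a b; rewrite /Z2_mul /= !add0r. Qed.

Lemma Z2_mul1r : right_id Z2_one Z2_mul.
Proof. by case=> a b; rewrite /Z2_mul /= !addr0. Qed.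

Lemma Z2_mulV : left_inverse Z2_one Z2_inv Z2_mul.
Proof. by case=> a b; rewrite /Z2_mul /= !addNr. Qed.

Lemma Z2_mulVr : right_inverse Z2_one Z2_inv Z2_mul.
Proof. by case=> a b; rewrite /Z2_mul /= !addrN. Qed.

HB.instance Definition _ :=
  isGroup.Build Z2 Z2_mulA Z2_mul1 Z2_mul1r Z2_mulV Z2_mulVr.

Definition cross : set Z2 :=
  [set s | s \in [:: (0, 0); (0, 1); (0, -1); (1, 0); (-1, 0)]].

(* Main.v *)
Require Import Defs.
From mathcomp Require Import all_boot all_order all_algebra finmap.
From mathcomp Require Import boolp classical_sets reals complex.
From mathcomp Require Import ring lra.

(** The obstruction is that decomposing along the two axes of the cross forgets
    that the two generators of the integer lattice commute.

    A finite set whose differences lie in the cross is contained in a single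
    row or a single column [cross_difference_line].  Up to a unimodular factor
    that cancels in y y^*, each y is therefore a polynomial in one generator, so
    a sum of squares allowed by the factorisation property is P(u) + Q(v) with
    P and Q positive, u and v being the generators.  Such an element stays
    positive when u and v are replaced by any two unitaries, commuting or not.
    Positivity in matrices over the commutative group algebra, on the other
    hand, only tests scalar values of u and v.

    The Pauli matrices X and Z tell the two apart.  Put

      z = 3/2 - X Re(u) - Z Re(v).

    For scalars, X cos(s) + Z cos(t) squares to cos(s)^2 + cos(t)^2 because X
    and Z anticommute, so its norm is at most sqrt 2 < 3/2 and z is positive.
    Substituting u := X and v := Z gives 3/2 - (X (x) X + Z (x) Z), whose value
    on the maximally entangled vector is 3/2 - 2; adding 1/4 leaves it negative.

    Positivity of z has to be shown in an abstract C*-algebra, through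
    invertibility [pauli_pencil_positive].  Since X Re(u) + Z Re(v) has a scalar
    square, m - X Re(u) - Z Re(v) is invertible as soon as the single element
    m^2 - Re(u)^2 - Re(v)^2 is.  As u and v are unitary, this element is
    m^2 - 1 - c for a self-adjoint c of norm at most 1, whose spectrum the
    Neumann series confines to the real interval from -1 to 1
    [contraction_spectrum].

    For the negative part only four characters of the lattice are needed, those
    with values 1 and -1.  Their multiples of the identity are unitary
    representations in the group C*-algebra itself, so its universal property
    turns a factorisation of z + 1/4 into identities between complex matrices
    [factorisation_eval].  The vector state above, applied after the
    substitution, is a combination of these four evaluations
    [pauli_functional]: it is nonnegative on every admissible square
    [pauli_functional_gram_ge0] and equals -1 on z + 1/4. *)

Set Implicit Arguments.
Unset Strict Implicit.
Unset Printing Implicit Defensive.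

Import Order.TTheory GRing.Theory Num.Theory.
Import Normc.
Local Open Scope ring_scope.
Local Open Scope complex_scope.

(** * Invertibility *)

Definition inverse_pair (T : pzRingType) (x w : T) : Prop :=
  w * x = 1 /\ x * w = 1.

Definition invertible (T : pzRingType) (x : T) : Prop :=
  exists w, inverse_pair x w.

Lemma invertible_of_sides (T : pzRingType) (x l r : T) :
  l * x = 1 -> x * r = 1 -> invertible x.
Proof.
move=> lx xr; have lr : l = r by rewrite -[l]mulr1 -xr mulrA lx mul1r.
by exists r; split; rewrite // -lr.
Qed.

(** Elements of a noncommutative ring need both products, since each supplies
    one of the two one-sided inverses of x. *)
Lemma invertible_factor (T : pzRingType) (x y d : T) :
  x * y = d -> y * x = d -> invertible d -> invertible x.
Proof.
move=> xy yx [w [wd dw]]; apply: (@invertible_of_sides _ _ (w * y) (y * w)).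
  by rewrite -mulrA yx.
by rewrite mulrA xy.
Qed.

Lemma invertible_scalar_mx (T : pzRingType) (n : nat) (d : T) :
  invertible d -> invertible (d%:M : 'M[T]_n.+1).
Proof.
move=> [w [wd dw]]; exists w%:M.
by split; apply: etrans (esym (scalar_mxM _ _ _)) _; rewrite ?wd ?dw.
Qed.

(** * The norm of a C*-algebra and the Neumann series *)

(** The sum of the first n powers is at least n q^n, and 1 - q times this sum is
    at most 1: this gives a decay of order 1/n, enough to conclude by the
    Archimedean property. *)
Lemma geometric_small (R : realType) (q e : R) :
  0 <= q < 1 -> 0 < e -> exists N, forall n, (N <= n)%N -> q ^+ n < e.
Proof.
move=> /andP[q0 q1] e0.
have d0 : 0 < 1 - q by rewrite subr_gt0.
have step n : (1 - q) * (q ^+ n *+ n) <= 1 - q ^+ n.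
  have -> : 1 - q ^+ n = (1 - q) * \sum_(i < n) q ^+ i.
    by rewrite -[in LHS](opprB (q ^+ n)) subrX1 -mulNr opprB.
  rewrite ler_pM2l //.
  have -> : q ^+ n *+ n = \sum_(i < n) q ^+ n by rewrite sumr_const card_ord.
  apply: ler_sum => i _.
  by apply: ler_wiXn2l; rewrite ?q0 ?(ltW q1) // ltnW.
pose N := (Num.truncn ((1 - q)^-1 * e^-1)).+1.
exists N => n Nn.
have n_big : (1 - q)^-1 * e^-1 < n%:R.
  apply: (@lt_le_trans _ _ N%:R); last by rewrite ler_nat.
  have /truncn_itv/andP[] // : 0 <= (1 - q)^-1 * e^-1.
  by rewrite mulr_ge0 // invr_ge0 ltW.
have ne : 1 < (1 - q) * (e * n%:R).
  rewrite -(@ltr_pM2l _ ((1 - q) * e)) ?mulr_gt0 // in n_big.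
  move: n_big; rewrite mulrA -[(1 - q) * e / (1 - q)]mulrAC mulfV ?gt_eqF //.
  by rewrite mul1r mulfV ?gt_eqF // mulrA.
have := step n; rewrite -mulr_natr => h.
have qn : 0 <= q ^+ n by rewrite exprn_ge0.
rewrite ltNge; apply/negP => eq.
have : (1 - q) * (e * n%:R) <= (1 - q) * (q ^+ n * n%:R).
  by rewrite ler_pM2l // ler_wpM2r // ler0n.
lra.
Qed.

Section CStarNorm.
Variables (R : realType) (A : cstarAlgType R).
Implicit Types (a b x : A) (k : R[i]).

Lemma cnorm0 : cnorm (0 : A) = 0.
Proof. by rewrite -(scale0r (0 : A)) cnormZ normc0 mul0r. Qed.

Lemma cnormN a : cnorm (- a) = cnorm a.
Proof.
rewrite -scaleN1r cnormZ (_ : normc (-1) = 1) ?mul1r //=.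
by rewrite sqrrN expr1n oppr0 expr0n addr0 sqrtr1.
Qed.

Lemma cnorm_ge0 a : 0 <= cnorm a.
Proof. by have := cnormD a (- a); rewrite subrr cnorm0 cnormN; lra. Qed.

Lemma star1 : star (1 : A) = 1.
Proof. by rewrite -[LHS]mulr1 -[X in _ * X]starK -starM mulr1 starK. Qed.

Lemma cnorm1 : cnorm (1 : A) = 1.
Proof.
have := cnorm_star (1 : A); rewrite star1 mulr1 => h.
have n0 : cnorm (1 : A) != 0.
  by apply/negP => /eqP/cnorm_eq0/eqP; rewrite oner_eq0.
by apply: (mulfI n0); rewrite mulr1 -expr2 -h.
Qed.

Lemma star0 : star (0 : A) = 0.
Proof. by apply: (addrI (star (0 : A))); rewrite -starD !addr0. Qed.

Lemma starN a : star (- a) = - star a.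
Proof. by apply: (addrI (star a)); rewrite -starD !subrr star0. Qed.

Lemma star_scalar k : star (k%:A : A) = (k^*)%:A.
Proof. by rewrite starZ star1. Qed.

Lemma cnormX x n : cnorm (x ^+ n) <= cnorm x ^+ n.
Proof.
elim: n => [|n IH]; first by rewrite !expr0 cnorm1.
rewrite !exprS; apply: le_trans (cnormM _ _) _.
by apply: ler_wpM2l IH; apply: cnorm_ge0.
Qed.

Lemma cnorm_unitary a : star a * a = 1 -> cnorm a = 1.
Proof.
move=> h; have := cnorm_star a; rewrite h cnorm1 => /eqP.
by rewrite eq_sym sqrp_eq1 ?cnorm_ge0 // => /eqP.
Qed.

(** Lets identities pass to a limit without naming the limit of a product. *)
Lemma eq0_of_cnorm_small a (K : R) :
  (forall e, 0 < e -> cnorm a <= K * e) -> a = 0.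
Proof.
move=> h; apply: cnorm_eq0; apply/eqP; rewrite eq_le cnorm_ge0 andbT.
rewrite leNgt; apply/negP => a0.
have K0 : 0 < K by have := h 1 ltr01; lra.
have := h (cnorm a / (2 * K)).
rewrite divr_gt0 ?mulr_gt0 // => /(_ isT).
have -> : K * (cnorm a / (2 * K)) = cnorm a / 2 by field; rewrite ?gt_eqF.
lra.
Qed.

(** The inverse is the limit of the partial geometric sums; it exists by
    completeness, the tails being dominated by those of a real series. *)
Lemma neumann x : cnorm x < 1 -> invertible (1 - x).
Proof.
move=> x1; set q := cnorm x in x1; have q0 : 0 <= q := cnorm_ge0 x.
have q01 : 0 <= q < 1 by rewrite q0.
pose S n := \sum_(i < n) x ^+ i.
have tail n d : cnorm (S (n + d)%N - S n) * (1 - q) <= q ^+ n - q ^+ (n + d).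
  elim: d => [|d IH]; first by rewrite addn0 !subrr cnorm0 mul0r.
  (* The bound telescopes: q^k (1 - q) = q^k - q^(k+1). *)
  rewrite addnS {1}/S big_ord_recr /= -/(S _) addrAC exprS.
  have h1 := cnormD (S (n + d)%N - S n) (x ^+ (n + d)).
  have h2 : cnorm (x ^+ (n + d)) * (1 - q) <= q ^+ (n + d) * (1 - q).
    by rewrite ler_wpM2r ?cnormX //; lra.
  have h3 := ler_wpM2r (_ : 0 <= 1 - q) h1.
  have := h3 ltac:(lra); lra.
have tail_lt e n m : 0 < e -> (n <= m)%N -> q ^+ n < e * (1 - q) ->
    cnorm (S m - S n) < e.
  move=> e0 nm hn; have := tail n (m - n)%N; rewrite subnKC // => h.
  have qm : 0 <= q ^+ m by rewrite exprn_ge0.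
  rewrite -(@ltr_pM2r _ (1 - q)); lra.
have [l hl] : exists l : A, forall e : R, 0 < e ->
    exists N, forall n, (N <= n)%N -> cnorm (S n - l) < e.
  apply: cnorm_complete => e e0.
  have ed0 : 0 < e * (1 - q) by rewrite mulr_gt0 //; lra.
  have [N hN] := geometric_small q01 ed0.
  exists N => m n Nm Nn.
  have [nm|mn] := leqP n m.
    by apply: tail_lt => //; apply: hN.
  rewrite -cnormN opprB; apply: tail_lt => //; first exact: ltnW.
  exact: hN.
have small e : 0 < e -> exists n, cnorm (l - S n) < e /\ cnorm (x ^+ n) < e.
  move=> e0; have [N1 h1] := hl e e0; have [N2 h2] := geometric_small q01 e0.
  exists (maxn N1 N2); split.
    by rewrite -cnormN opprB h1 ?leq_maxl.
  by apply: le_lt_trans (cnormX _ _) _; rewrite h2 ?leq_maxr.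
have telel n : (1 - x) * S n = 1 - x ^+ n.
  by rewrite -[in RHS](opprB (x ^+ n)) subrX1 -mulNr opprB.
have teler n : S n * (1 - x) = 1 - x ^+ n.
  rewrite -telel; apply/commr_sym/commr_sum => i _; apply/commr_sym.
  by apply: commrB; [exact: commr1 | apply/commr_sym/commrX].
have n1 := cnorm_ge0 (1 - x).
exists l; split; apply/subr0_eq;
  apply: (@eq0_of_cnorm_small _ (cnorm (1 - x) + 1)) => e e0;
  have [n [h1 h2]] := small e e0.
  have -> : l * (1 - x) - 1 = (l - S n) * (1 - x) - x ^+ n.
    by rewrite mulrBl teler opprB addrA [RHS]addrAC addrK.
  have := cnormD ((l - S n) * (1 - x)) (- x ^+ n).
  have := cnormM (l - S n) (1 - x); rewrite cnormN.
  have := ler_wpM2r n1 (ltW h1); lra.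
have -> : (1 - x) * l - 1 = (1 - x) * (l - S n) - x ^+ n.
  by rewrite mulrBr telel opprB addrA [RHS]addrAC addrK.
have := cnormD ((1 - x) * (l - S n)) (- x ^+ n).
have := cnormM (1 - x) (l - S n); rewrite cnormN.
have := ler_wpM2r n1 (ltW h1); lra.
Qed.

End CStarNorm.

(** * Spectra of self-adjoint elements *)

Section SelfAdjointSpectrum.
Variables (R : realType) (A : cstarAlgType R).
Implicit Types (a x : A) (k : R[i]).

Lemma invertible_scale k x : k != 0 -> invertible x -> invertible (k *: x).
Proof.
move=> k0 [w [wx xw]]; exists (k^-1 *: w).
by split; rewrite -scalerAl -scalerAr scalerA ?mulVf ?mulfV // scale1r.
Qed.

Lemma invertible_sub_scalar x k : cnorm x < normc k -> invertible (x - k%:A).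
Proof.
move=> xk; have k0 : k != 0.
  by apply/eqP => k0; move: xk; rewrite k0 normc0 ltNge cnorm_ge0.
have -> : x - k%:A = (- k) *: (1 - k^-1 *: x).
  by rewrite scalerBr scalerA mulNr mulfV // !scaleNr scale1r opprK addrC.
apply: invertible_scale; first by rewrite oppr_eq0.
apply: neumann; rewrite cnormZ normcV mulrC ltr_pdivrMr ?mul1r //.
exact: le_lt_trans (cnorm_ge0 x) xk.
Qed.

(** The C*-identity applies: (a + it)^* (a + it) = a^2 + t^2, the cross terms
    cancelling because a is self-adjoint. *)
Lemma cnorm_selfadjoint_shift a (t : R) :
  star a = a -> cnorm (a + (0 +i* t)%:A) ^+ 2 <= cnorm a ^+ 2 + t ^+ 2.
Proof.
move=> sa; rewrite -!cnorm_star starD star_scalar sa.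
have -> : (a + ((0 +i* t)^*)%:A) * (a + (0 +i* t)%:A) =
    a * a + ((t ^+ 2)%:C)%:A.
  rewrite mulrDl !mulrDr -!addrA; congr (_ + _).
  rewrite -!scalerAl -!scalerAr !mul1r !mulr1 scalerA addrA -scalerDl.
  have -> : 0 +i* t + (0 +i* t)^* = 0 :> R[i].
    by apply/eqP; rewrite eq_complex /= addr0 subrr !eqxx.
  rewrite scale0r add0r; congr (_ *: _); apply/eqP; rewrite eq_complex /=.
  by apply/andP; split; apply/eqP; ring.
apply: le_trans (cnormD _ _) _; rewrite cnormZ cnorm1 mulr1 lerD2l /=.
by rewrite expr0n addr0 sqrtr_sqr ger0_norm ?sqr_ge0.
Qed.

(** Adding i t to b = a - p moves the scalar i q to i (t + q).  The square of
    the norm of b + i t grows like t^2 while that of i (t + q) also gains the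
    term 2 t q, so for a suitable t the Neumann series applies. *)
Lemma selfadjoint_nonreal a (p q : R) :
  star a = a -> q != 0 -> invertible (a - (p +i* q)%:A).
Proof.
move=> sa q0; pose b := a - (p%:C)%:A.
have sb : star b = b.
  rewrite starD starN star_scalar sa; congr (_ - _ *: _).
  by apply/eqP; rewrite eq_complex /= oppr0 !eqxx.
(* With this t, (t + q)^2 exceeds |b|^2 + t^2 by exactly q^2. *)
pose t := cnorm b ^+ 2 / (2 * q).
have -> : a - (p +i* q)%:A = b + (0 +i* t)%:A - (0 +i* (t + q))%:A.
  rewrite /b -!addrA; congr (_ + _); rewrite -!scaleNr -!scalerDl.
  congr (_ *: _); apply/eqP; rewrite eq_complex /=.
  by apply/andP; split; apply/eqP; ring.
apply: invertible_sub_scalar; rewrite /= expr0n add0r sqrtr_sqr.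
rewrite -(@ltr_pXn2r _ 2) ?nnegrE ?cnorm_ge0 // real_normK ?num_real //.
apply: le_lt_trans (cnorm_selfadjoint_shift _ sb) _.
have -> : (t + q) ^+ 2 = t ^+ 2 + cnorm b ^+ 2 + q ^+ 2 by rewrite /t; field.
have : 0 < q ^+ 2 by rewrite exprn_even_gt0.
lra.
Qed.

Lemma contraction_spectrum a k :
  star a = a -> cnorm a <= 1 -> ~ invertible (a - k%:A) ->
  complex.Im k = 0 /\ `|complex.Re k| <= 1.
Proof.
case: k => p q sa a1 ninv /=.
have q0 : q = 0.
  by apply/eqP/negPn/negP => q0; apply: ninv; apply: selfadjoint_nonreal.
split=> //; rewrite leNgt; apply/negP => p1; apply: ninv.
apply: invertible_sub_scalar; rewrite /= q0 [0 ^+ 2]expr0n addr0 sqrtr_sqr.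
exact: le_lt_trans a1 p1.
Qed.

End SelfAdjointSpectrum.

(** * Elementary tensors and the Pauli matrices *)

Section Tensor.
Variables (R : realType) (A : cstarAlgType R) (n : nat).
Implicit Types (M N : 'M[R[i]]_n) (a b : A).

Definition adjmx M : 'M[R[i]]_n := (map_mx Num.conj M)^T.

Lemma mxtensorDr M a b : mxtensor M (a + b) = mxtensor M a + mxtensor M b.
Proof. by apply/matrixP => i j; rewrite !mxE scalerDr. Qed.

Lemma mxtensorN M a : mxtensor (- M) a = - mxtensor M a.
Proof. by apply/matrixP => i j; rewrite !mxE scaleNr. Qed.

Lemma mxtensorZ k M a : mxtensor (k *: M) a = mxtensor M (k *: a).
Proof. by apply/matrixP => i j; rewrite !mxE scalerA mulrC. Qed.

Lemma mxtensorM M N a b :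
  mxtensor M a *m mxtensor N b = mxtensor (M *m N) (a * b).
Proof.
apply/matrixP => i j; rewrite !mxE scaler_suml; apply: eq_bigr => k _.
by rewrite !mxE -scalerAl -scalerAr scalerA.
Qed.

Lemma mxtensor_scalar a : mxtensor 1%:M a = a%:M :> 'M[A]_n.
Proof. by apply/matrixP => i j; rewrite !mxE scaler_nat. Qed.

Lemma mxstarD (x y : 'M[A]_n) : mxstar (x + y) = mxstar x + mxstar y.
Proof. by apply/matrixP => i j; rewrite !mxE starD. Qed.

Lemma mxstarN (x : 'M[A]_n) : mxstar (- x) = - mxstar x.
Proof. by apply/matrixP => i j; rewrite !mxE starN. Qed.

Lemma mxstar_tensor M a : mxstar (mxtensor M a) = mxtensor (adjmx M) (star a).
Proof. by apply/matrixP => i j; rewrite !mxE starZ. Qed.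

End Tensor.

Section Pauli.
Variable R : realType.

Definition pauliX : 'M[R[i]]_2 := \matrix_(i, j) (i != j)%:R.
Definition pauliZ : 'M[R[i]]_2 := \matrix_(i, j) ((-1) ^+ i *+ (i == j)).

Lemma mx2P (T : Type) (M N : 'M[T]_2) :
  M 0 0 = N 0 0 -> M 0 1 = N 0 1 -> M 1 0 = N 1 0 -> M 1 1 = N 1 1 -> M = N.
Proof.
move=> h00 h01 h10 h11; apply/matrixP => i j.
have ord2 (k : 'I_2) : k = 0 \/ k = 1.
  by case: k => [[|[|k]] hk] //; [left | right]; apply: val_inj.
by case: (ord2 i) => ->; case: (ord2 j) => ->.
Qed.

Lemma pauliX_sqr : pauliX *m pauliX = 1%:M.
Proof. by apply: mx2P; rewrite !mxE !big_ord_recl big_ord0 !mxE /=; ring. Qed.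

Lemma pauliZ_sqr : pauliZ *m pauliZ = 1%:M.
Proof. by apply: mx2P; rewrite !mxE !big_ord_recl big_ord0 !mxE /=; ring. Qed.

Lemma pauli_anticomm : pauliX *m pauliZ = - (pauliZ *m pauliX).
Proof. by apply: mx2P; rewrite !mxE !big_ord_recl !big_ord0 !mxE /=; ring. Qed.

Lemma pauliX_adj : adjmx pauliX = pauliX.
Proof. by apply: mx2P; rewrite !mxE ?rmorph1 ?rmorph0. Qed.

Lemma pauliZ_adj : adjmx pauliZ = pauliZ.
Proof. by apply: mx2P; rewrite !mxE ?rmorphN ?rmorph1 ?rmorph0. Qed.

End Pauli.

(** * Positivity of the Pauli pencil *)

Section Positivity.
Variables (R : realType) (A : cstarAlgType R).
Implicit Types (u v : A).

Lemma normc_real (p : R) : normc (p%:C) = `|p|.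
Proof. by rewrite /= [0 ^+ 2]expr0n addr0 sqrtr_sqr. Qed.

Definition real_part u : A := 2^-1 *: (u + star u).

Lemma real_part_star u : star (real_part u) = real_part u.
Proof. by rewrite starZ starD starK fmorphV rmorph_nat addrC. Qed.

Lemma real_part_sqr u : star u * u = 1 -> u * star u = 1 ->
  real_part u * real_part u = 2^-1%:A + 4^-1 *: (u * u + star u * star u).
Proof.
move=> su us; rewrite -scalerAl -scalerAr scalerA mulrDl !mulrDr su us.
have -> : u * u + 1 + (1 + star u * star u) =
    (u * u + star u * star u) + (2 : R[i])%:A.
  by rewrite -addrA [1 + (1 + _)]addrA [1 + 1 + _]addrC addrA scaler_nat mulr2n.
rewrite scalerDr addrC scalerA; congr (_ *: _ + _ *: _); by field.
Qed.

(** For unitaries, commuting with v forces commuting with its inverse. *)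
Lemma comm_star_unitary u v : star v * v = 1 -> v * star v = 1 ->
  GRing.comm u v -> GRing.comm u (star v).
Proof.
move=> sv vs uv; rewrite /GRing.comm -[LHS]mul1r -sv -mulrA [v * _]mulrA -uv.
by rewrite -[u * v * _]mulrA vs mulr1.
Qed.

Lemma real_part_comm u v :
  star u * u = 1 -> u * star u = 1 -> star v * v = 1 -> v * star v = 1 ->
  GRing.comm u v -> GRing.comm (real_part u) (real_part v).
Proof.
move=> su us sv vs uv.
have step w w' : star w' * w' = 1 -> w' * star w' = 1 ->
    GRing.comm w w' -> GRing.comm w (real_part w').
  move=> h1 h2 ww'; rewrite /GRing.comm -scalerAr -scalerAl; congr (_ *: _).
  exact: commrD ww' (comm_star_unitary h1 h2 ww').
by apply/commr_sym/step => //; apply/commr_sym/step.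
Qed.

Definition pauli_pencil u v : 'M[A]_2 :=
  mxtensor (pauliX R) (real_part u) + mxtensor (pauliZ R) (real_part v).

(** Anticommutation of X and Z cancels the mixed terms, which reduces spectral
    questions about this matrix to questions in the algebra itself. *)
Lemma pauli_pencil_sqr u v : GRing.comm (real_part u) (real_part v) ->
  pauli_pencil u v *m pauli_pencil u v =
    (real_part u * real_part u + real_part v * real_part v)%:M.
Proof.
move=> uv; rewrite /pauli_pencil mulmxDl !mulmxDr !mxtensorM uv.
rewrite pauliX_sqr pauliZ_sqr pauli_anticomm mxtensorN -!mxtensor_scalar.
by rewrite mxtensorDr addrA -[X in X + _]addrA addNr addr0.
Qed.

(** Multiplying m - X by m + X gives the scalar matrix m^2 - 1 - c, where c
    gathers the nonconstant terms of Re(u)^2 + Re(v)^2.  If m is in the spectrum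
    then m^2 - 1 is in that of c, hence real and between -1 and 1: so m^2 is
    real and between 0 and 2, which excludes an imaginary part of m. *)
Lemma pauli_pencil_spectrum u v (m : R[i]) :
  star u * u = 1 -> u * star u = 1 -> star v * v = 1 -> v * star v = 1 ->
  GRing.comm u v ->
  ~ invertible ((m%:A)%:M - pauli_pencil u v) ->
  complex.Im m = 0 /\ complex.Re m ^+ 2 <= 2.
Proof.
move=> su us sv vs uv ninv.
pose c := 4^-1 *: (u * u + star u * star u + (v * v + star v * star v)).
have sc : star c = c.
  rewrite starZ !starD !starM !starK fmorphV rmorph_nat.
  by congr (_ *: (_ + _)); rewrite addrC.
have unit_sqr (w : A) : star w * w = 1 -> w * star w = 1 ->
    cnorm (w * w + star w * star w) <= 2.
  move=> h1 h2; apply: le_trans (cnormD _ _) _.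
  have n1 : cnorm w = 1 := cnorm_unitary h1.
  have n2 : cnorm (star w) = 1 by apply: cnorm_unitary; rewrite starK.
  have := cnormM w w; have := cnormM (star w) (star w).
  rewrite n1 n2; lra.
have c1 : cnorm c <= 1.
  rewrite cnormZ (_ : normc (4^-1) = 4^-1).
    have := cnormD (u * u + star u * star u) (v * v + star v * star v).
    have := unit_sqr u su us; have := unit_sqr v sv vs; lra.
  rewrite (_ : 4 = (4 : R)%:C); last by rewrite rmorph_nat.
  by rewrite normcV normc_real ger0_norm.
have [|im0 re1] := @contraction_spectrum _ _ c (m ^+ 2 - 1) sc c1.
  move=> inv; apply: ninv.
  pose X := pauli_pencil u v; pose D := m%:A%:M : 'M[A]_2.
  have XX : X * X = (c + 1)%:M.
    rewrite [LHS]pauli_pencil_sqr; last exact: real_part_comm.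
    rewrite !real_part_sqr // addrACA -scalerDl -scalerDr addrC.
    congr ((_ + _)%:M).
    rewrite -[RHS]scale1r; congr (_ *: _); by field.
  have XD : X * D = D * X.
    apply/esym; rewrite [LHS](_ : _ = D *m X) // [RHS](_ : _ = X *m D) //.
    rewrite /D -mxtensor_scalar /X /pauli_pencil mulmxDl mulmxDr !mxtensorM.
    by rewrite !mul1mx !mulmx1 !mulr_algl !mulr_algr.
  have DD : D * D = ((m ^+ 2)%:A)%:M.
    rewrite [LHS](_ : _ = D *m D) // -scalar_mxM; congr (_%:M).
    by rewrite mulr_algl scalerA.
  have diff : D * D - X * X = (- (c - (m ^+ 2 - 1)%:A))%:M.
    rewrite DD XX -raddfB; congr (_%:M).
    by rewrite opprB scalerBl scale1r opprD addrA [RHS]addrAC.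
  apply: (@invertible_factor _ _ (D + X) (- (c - (m ^+ 2 - 1)%:A))%:M).
  - by rewrite -diff mulrDr !mulrBl XD addrA subrK.
  - by rewrite -diff mulrDl !mulrBr XD addrA subrK.
  - have n1 : -1 != 0 :> R[i] by rewrite oppr_eq0 oner_eq0.
    by apply: invertible_scalar_mx; rewrite -scaleN1r; apply: invertible_scale.
case: m im0 re1 {ninv} => p q; rewrite expr2 /= => im0 re1.
have pq : p * q = 0 by lra.
have re2 : p ^+ 2 - q ^+ 2 <= 2 /\ 0 <= p ^+ 2 - q ^+ 2.
  by move: re1; rewrite ler_norml => /andP[]; rewrite !expr2; lra.
have q0 : q = 0.
  case/eqP: pq; rewrite mulf_eq0 => /orP[] /eqP // p0; apply/eqP.
  by rewrite -sqrf_eq0 eq_le sqr_ge0 andbT; move: re2; rewrite p0; nra.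
by split => //; move: re2; rewrite q0; nra.
Qed.

(** Every spectral value l has c - l in the spectrum of the pencil, hence l real
    and at least c - sqrt 2. *)
Lemma pauli_pencil_positive u v (c : R) :
  star u * u = 1 -> u * star u = 1 -> star v * v = 1 -> v * star v = 1 ->
  GRing.comm u v -> 0 <= c -> 2 <= c ^+ 2 ->
  mxpositive ((c%:C%:A)%:M - pauli_pencil u v).
Proof.
move=> su us sv vs uv c0 c2; split.
  rewrite mxstarD mxstarN mxstarD !mxstar_tensor !real_part_star.
  rewrite pauliX_adj pauliZ_adj; congr (_ - _).
  rewrite -mxtensor_scalar mxstar_tensor star_scalar.
  congr (mxtensor _ (_ *: _)).
    by rewrite /adjmx map_scalar_mx rmorph1 tr_scalar_mx.
  by apply/eqP; rewrite eq_complex /= oppr0 !eqxx.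
move=> l hl; have [] := @pauli_pencil_spectrum u v (c%:C - l) su us sv vs uv.
  move=> [w [h1 h2]]; apply: hl; exists w.
  have e : (c%:C%:A)%:M - pauli_pencil u v - (l%:A)%:M
     = ((c%:C - l)%:A)%:M - pauli_pencil u v.
    by rewrite addrAC -raddfB /= scalerBl.
  by rewrite e.
case: l hl => p q _; rewrite lecE /= add0r => /eqP; rewrite oppr_eq0.
by move=> /eqP -> h; rewrite eqxx /=; nra.
Qed.
End Positivity.

(** * Evaluation at characters of the lattice *)

Section Characters.
Variables (R : realType) (A : cstarAlgType R).
Local Notation C := R[i].
Implicit Types (a b : C) (s t : Z2).

Definition z2char a b s : C := a ^ s.1 * b ^ s.2.

Lemma unimodular_neq0 a : a^* * a = 1 -> a != 0.
Proof. by apply: contra_eq_neq => ->; rewrite mulr0 eq_sym oner_eq0. Qed.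

Lemma unimodularX a (m : int) : a^* * a = 1 -> (a ^ m)^* * a ^ m = 1.
Proof.
move=> ha; have a0 := unimodular_neq0 ha.
by rewrite fmorphXz -exprzMl ?unitfE ?fmorph_eq0 // ha exp1rz.
Qed.

Lemma z2char_unimodular a b s :
  a^* * a = 1 -> b^* * b = 1 -> (z2char a b s)^* * z2char a b s = 1.
Proof.
by move=> ha hb; rewrite rmorphM mulrACA !unimodularX // mulr1.
Qed.

(** Taking values in A itself avoids making the complex numbers into a
    C*-algebra: only the scalar multiples of the identity of A occur. *)
Lemma z2char_rep a b : a^* * a = 1 -> b^* * b = 1 ->
  unitary_rep (fun s => (z2char a b s)%:A : A).
Proof.
move=> ha hb; split=> [s t|s].
  rewrite mulr_algl scalerA; congr (_ *: _).
  by rewrite /z2char /= !expfzDr ?unimodular_neq0 // mulrACA.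
rewrite star_scalar !mulr_algl !scalerA [z2char _ _ _ * _]mulrC.
by rewrite z2char_unimodular // scale1r.
Qed.

End Characters.

Section Evaluation.
Variables (R : realType) (A : cstarAlgType R) (n : nat).
Local Notation C := R[i].
Implicit Types (S : {fset Z2}) (N : Z2 -> 'M[C]_n).

Definition trigeval (a b : C) S N : 'M[C]_n :=
  \sum_(s <- S) z2char a b s *: N s.

Lemma z2char1 (a b : C) : z2char a b 1%g = 1.
Proof. exact: mulr1. Qed.

Lemma map_mxtensor (delta : Z2 -> A) (phi : {lrmorphism A -> A}) a b M s :
  (forall s, phi (delta s) = (z2char a b s)%:A) ->
  map_mx phi (mxtensor M (delta s)) =
    map_mx (GRing.in_alg A) (z2char a b s *: M) :> 'M[A]_n.
Proof.
move=> hphi; apply/matrixP => i j.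
by rewrite !mxE linearZ /= hphi scalerA mulrC.
Qed.

Lemma map_trigsum (delta : Z2 -> A) (phi : {lrmorphism A -> A}) a b S N :
  (forall s, phi (delta s) = (z2char a b s)%:A) ->
  map_mx phi (trigsum delta S N) = map_mx (GRing.in_alg A) (trigeval a b S N).
Proof.
move=> hphi; rewrite /trigsum /trigeval !raddf_sum; apply: eq_bigr => s _.
exact: map_mxtensor.
Qed.

Lemma map_mxstar (phi : {lrmorphism A -> A}) (y : 'M[A]_n) :
  star_morphism phi -> map_mx phi (mxstar y) = mxstar (map_mx phi y).
Proof. by move=> hphi; apply/matrixP => i j; rewrite !mxE hphi. Qed.

Lemma mxstar_in_alg (M : 'M[C]_n) :
  mxstar (map_mx (GRing.in_alg A) M) = map_mx (GRing.in_alg A) (adjmx M).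
Proof. by apply/matrixP => i j; rewrite !mxE star_scalar. Qed.

(** The universal property is applied with target A and the scalar-valued
    representation of a character; the resulting equality between scalar
    matrices over A descends to complex matrices. *)
Lemma factorisation_eval (delta : Z2 -> A) (hA : universal_group_cstar delta)
    (S0 : {fset Z2}) (M : Z2 -> 'M[C]_n) (eps : R)
    (r : nat) (S : 'I_r -> {fset Z2}) (N : 'I_r -> Z2 -> 'M[C]_n) :
  trigsum delta S0 M + mxtensor (eps%:C *: 1%:M) (delta 1%g) =
    \sum_(i < r) trigsum delta (S i) (N i)
                   *m mxstar (trigsum delta (S i) (N i)) ->
  forall a b : C, a^* * a = 1 -> b^* * b = 1 ->
  trigeval a b S0 M + eps%:C%:M =
    \sum_(i < r) trigeval a b (S i) (N i) *m adjmx (trigeval a b (S i) (N i)).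
Proof.
move=> heq a b ha hb.
have [phi [phistar hphi _]] := hA.2 A _ (z2char_rep A ha hb).
have inj : injective (map_mx (GRing.in_alg A) : 'M[C]_n -> 'M[A]_n).
  move=> x y /matrixP h; apply/matrixP => i j; have := h i j; rewrite !mxE.
  exact: (fmorph_inj (GRing.in_alg A)).
apply: inj; rewrite raddfD [RHS]raddf_sum /=.
have := congr1 (map_mx phi) heq.
rewrite raddfD [X in _ = X -> _]raddf_sum /= (map_trigsum _ _ hphi).
rewrite (map_mxtensor _ _ hphi) z2char1 scale1r scalemx1.
move=> ->; apply: eq_bigr => i _.
rewrite [LHS]map_mxM (map_mxstar _ phistar) (map_trigsum _ _ hphi).
by rewrite mxstar_in_alg [RHS]map_mxM.
Qed.

End Evaluation.

(** * The functional that detects noncommutativity *)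

Section Functional.
Variable R : realType.
Local Notation C := R[i].
Local Notation X := (pauliX R).
Local Notation Z := (pauliZ R).

(** For F(u, v) a combination of 1, u, u^-1, v, v^-1 with matrix coefficients,
    F(1,1) + F(-1,-1) is twice the constant coefficient, while F(1,1) - F(-1,1)
    and F(1,1) - F(1,-1) are twice the sums of the two coefficients along each
    axis.  As <M (x) N> = tr (M N^T) / 2 for the maximally entangled vector and
    X and Z are symmetric, the formula computes four times the value of that
    vector state on F(X, Z), using nothing but evaluations at signs. *)
Definition pauli_functional (F : C -> C -> 'M[C]_2) : C :=
  \tr (F 1 1 + F (-1) (-1) + X *m (F 1 1 - F (-1) 1) + Z *m (F 1 1 - F 1 (-1))).

Lemma pauli_functional_eq (F G : C -> C -> 'M[C]_2) :
  (forall a b, a ^+ 2 = 1 -> b ^+ 2 = 1 -> F a b = G a b) ->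
  pauli_functional F = pauli_functional G.
Proof. by move=> FG; rewrite /pauli_functional !FG ?sqrrN ?expr1n. Qed.

Lemma pauli_functional_sum (r : nat) (F : 'I_r -> C -> C -> 'M[C]_2) :
  pauli_functional (fun a b => \sum_i F i a b) =
  \sum_i pauli_functional (F i).
Proof.
rewrite /pauli_functional -!sumrB !mulmx_sumr -!big_split /= raddf_sum.
by apply: eq_bigr => i _.
Qed.

Lemma adjmxM (n : nat) (M N : 'M[C]_n) : adjmx (M *m N) = adjmx N *m adjmx M.
Proof. by rewrite /adjmx map_mxM trmx_mul. Qed.

Lemma mxtrace_gram_ge0 (n : nat) (M : 'M[C]_n) : 0 <= \tr (M *m adjmx M).
Proof.
apply: sumr_ge0 => i _; rewrite !mxE; apply: sumr_ge0 => j _.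
by rewrite !mxE mul_conjC_ge0.
Qed.

(** The matrix 1 + s is twice a projection, hence half its own square: the trace
    becomes that of a Gram matrix. *)
Lemma mxtrace_reflection_gram_ge0 (n : nat) (s Y : 'M[C]_n) :
  adjmx s = s -> s *m s = 1%:M ->
  0 <= \tr (Y *m adjmx Y + s *m (Y *m adjmx Y)).
Proof.
move=> sa ss; pose K := 1%:M + s.
have Ka : adjmx K = K.
  by rewrite /K /adjmx map_mxD raddfD /= -/(adjmx s) sa map_mx1 trmx1.
have KK : K *m K = 2 *: K.
  rewrite /K mulmxDl !mulmxDr ss !mul1mx mulmx1 [s + _]addrC.
  by rewrite scaler_nat mulr2n.
have -> : Y *m adjmx Y + s *m (Y *m adjmx Y) =
    2^-1 *: (K *m (K *m Y *m adjmx Y)).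
  rewrite !mulmxA KK -!scalemxAl scalerA mulVf ?pnatr_eq0 // scale1r.
  by rewrite /K !mulmxDl mul1mx.
rewrite mxtraceZ mulr_ge0 ?invr_ge0 // mxtrace_mulC -[X in _ *m X]Ka.
by rewrite -[_ *m adjmx K]mulmxA -adjmxM mxtrace_gram_ge0.
Qed.

Lemma mxtrace_reflection_split_ge0 (n : nat) (s Y1 Y2 : 'M[C]_n) :
  adjmx s = s -> s *m s = 1%:M ->
  0 <= \tr (Y1 *m adjmx Y1 + Y2 *m adjmx Y2
           + s *m (Y1 *m adjmx Y1 - Y2 *m adjmx Y2)).
Proof.
move=> sa ss; set G1 := Y1 *m adjmx Y1; set G2 := Y2 *m adjmx Y2.
have -> : G1 + G2 + s *m (G1 - G2) = (G1 + s *m G1) + (G2 + (- s) *m G2).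
  by rewrite mulmxBr mulNmx addrACA.
rewrite mxtraceD addr_ge0 // mxtrace_reflection_gram_ge0 //.
  by rewrite /adjmx map_mxN raddfN /= -/(adjmx _) sa.
by rewrite mulmxN mulNmx opprK ss.
Qed.

(** If F depends on the first variable only, one unitary is substituted and its
    noncommutation with the other has no effect: the spectral projections of X
    split the functional into two nonnegative traces. *)
Lemma pauli_functional_row_ge0 (F : C -> C -> 'M[C]_2) (Y : C -> 'M[C]_2) :
  (forall a b, a ^+ 2 = 1 -> b ^+ 2 = 1 -> F a b = Y a *m adjmx (Y a)) ->
  0 <= pauli_functional F.
Proof.
move=> hF; rewrite /pauli_functional !hF ?sqrrN ?expr1n // subrr mulmx0 addr0.
exact: mxtrace_reflection_split_ge0 (pauliX_adj R) (pauliX_sqr R).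
Qed.

Lemma pauli_functional_col_ge0 (F : C -> C -> 'M[C]_2) (Y : C -> 'M[C]_2) :
  (forall a b, a ^+ 2 = 1 -> b ^+ 2 = 1 -> F a b = Y b *m adjmx (Y b)) ->
  0 <= pauli_functional F.
Proof.
move=> hF; rewrite /pauli_functional !hF ?sqrrN ?expr1n // subrr mulmx0 addr0.
exact: mxtrace_reflection_split_ge0 (pauliZ_adj R) (pauliZ_sqr R).
Qed.

Lemma pauli_functional_pencil (d : C) :
  pauli_functional (fun a b => d%:M - a *: X - b *: Z) = 4 * d - 8.
Proof.
rewrite /pauli_functional.
have e1 (x z : 'M[C]_2) :
    d%:M - 1 *: x - 1 *: z + (d%:M - -1 *: x - -1 *: z) = (2 * d)%:M.
  rewrite !scale1r !scaleN1r !opprK -[d%:M + x + z]addrA.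
  rewrite -[d%:M - x - z]addrA -opprD.
  by rewrite addrACA addNr addr0 -raddfD /= mulr_natl mulr2n.
have e2 (x z : 'M[C]_2) :
    d%:M - 1 *: x - 1 *: z - (d%:M - -1 *: x - 1 *: z) = - 2 *: x.
  rewrite !scale1r scaleN1r opprK opprB addrA subrK opprD addrA.
  by rewrite [_ - x - _]addrAC subrr add0r scaleNr scaler_nat mulr2n opprD.
have e3 (x z : 'M[C]_2) :
    d%:M - 1 *: x - 1 *: z - (d%:M - 1 *: x - -1 *: z) = - 2 *: z.
  rewrite !scale1r scaleN1r opprK opprD addrA [_ - z - _]addrAC.
  by rewrite subrr add0r scaleNr scaler_nat mulr2n opprD.
(* Generic x and z above: comparing the signs 1 and -1 by conversion inside
   the complex numbers is expensive. *)
transitivity (\tr ((2 * d)%:M + X *m (- 2 *: X) + Z *m (- 2 *: Z))).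
  by rewrite -(e1 X Z) -(e2 X Z) -(e3 X Z).
rewrite -!scalemxAr pauliX_sqr pauliZ_sqr !scalemx1 -!raddfD /= mxtrace_scalar.
ring.
Qed.

End Functional.

(** * Subsets whose differences lie in the cross *)

Local Open Scope classical_set_scope.

Section Cross.

Lemma cross_coord (s : Z2) : cross s -> s.1 = 0 \/ s.2 = 0.
Proof.
rewrite /cross /= !inE.
do 4![case/orP => [/eqP-> /= | ]; first by [left | right]].
by move/eqP ->; right.
Qed.

Lemma cross_positivity_domain : positivity_domain cross.
Proof.
have inv s : cross s -> cross s^-1%g.
  rewrite /cross /= !inE.
  by do 4![case/orP => [/eqP-> // | ]]; move/eqP ->.
split; first by [].
apply/seteqP; split=> [s [t ht <-] | s hs]; first exact: inv.
by exists s^-1%g; rewrite ?invgK //; apply: inv.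
Qed.

(** Two points of the set share a coordinate.  If s and t lie on a common row
    but in different columns, a third point cannot leave that row: it would have
    to share its column with both s and t. *)
Lemma cross_difference_line (S : {fset Z2}) :
  (forall s t, s \in S -> t \in S -> cross (s * t^-1)%g) ->
  (forall s t, s \in S -> t \in S -> s.2 = t.2) \/
  (forall s t, s \in S -> t \in S -> s.1 = t.1).
Proof.
move=> hS.
have coord s t : s \in S -> t \in S -> s.1 = t.1 \/ s.2 = t.2.
  move=> sS tS; have [/subr0_eq|/subr0_eq] := cross_coord (hS s t sS tS).
    by left.
  by right.
have [h|] := pselect (forall s t, s \in S -> t \in S -> s.1 = t.1).
  by right.
move/existsNP => [s /existsNP [t /not_implyP [sS /not_implyP [tS st]]]].
left.
have st2 : s.2 = t.2 by have [] := coord s t sS tS.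
have row r : r \in S -> r.2 = s.2.
  move=> rS; have [rs|//] := coord r s rS sS.
  by have [rt|->//] := coord r t rS tS; case: st; rewrite -rs.
by move=> p q pS qS; rewrite !row.
Qed.

End Cross.

(** * The positive element without factorisation *)

Section Witness.
Variables (R : realType) (A : cstarAlgType R).
Local Notation C := R[i].

(** Any constant c with 2 <= c^2 and c < 2 would serve: the first condition is
    positivity, and c + eps < 2 is what makes the functional negative. *)
Definition pencil_coef (s : Z2) : 'M[C]_2 :=
  if s == (0, 0) then ((3 / 2 : R)%:C)%:M
  else if s.2 == 0 then - (2^-1 *: pauliX R) else - (2^-1 *: pauliZ R).

Definition cross_seq : seq Z2 := [:: (0, 0); (0, 1); (0, -1); (1, 0); (-1, 0)].

Lemma cross_sum (V : nmodType) (F : Z2 -> V) :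
  \sum_(s <- seq_fset tt cross_seq) F s =
  F (0, 0) + (F (0, 1) + (F (0, -1) + (F (1, 0) + F (-1, 0)))).
Proof.
rewrite (perm_big _ (seq_fset_perm tt cross_seq)) undup_id // /cross_seq.
by rewrite !big_cons big_nil /= addr0.
Qed.

Lemma unitary_rep_star (G : groupType) (delta : G -> A) s :
  unitary_rep delta -> delta 1%g = 1 /\ star (delta s) = delta s^-1%g.
Proof.
move=> [dM dU].
have d1 : delta 1%g = 1.
  by rewrite -[LHS]mul1r -(dU 1%g).1 -mulrA -dM mulg1.
split=> //.
by rewrite -[LHS]mulr1 -d1 -(mulgV s) dM mulrA (dU s).1 mul1r.
Qed.

Lemma trigsum_pencil (delta : Z2 -> A) : unitary_rep delta ->
  trigsum delta (seq_fset tt cross_seq) pencil_coef =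
  (((3 / 2 : R)%:C)%:A)%:M - pauli_pencil (delta (1, 0)) (delta (0, 1)).
Proof.
move=> rep; rewrite /trigsum cross_sum /pencil_coef /=.
have [d1 _] := unitary_rep_star 1%g rep.
rewrite (d1 : delta (0, 0) = 1) /pauli_pencil /real_part.
rewrite (unitary_rep_star ((1, 0) : Z2) rep).2.
rewrite (unitary_rep_star ((0, 1) : Z2) rep).2.
rewrite opprD addrC [RHS]addrC; congr (_ + _); last first.
  by rewrite -scalemx1 mxtensorZ mxtensor_scalar.
by rewrite -!mxtensorN -!mxtensorZ !mxtensorDr !scalerN addrA addrC.
Qed.

Lemma trigeval_pencil (a b : C) :
  trigeval a b (seq_fset tt cross_seq) pencil_coef =
  ((3 / 2 : R)%:C)%:M - (2^-1 * (a + a^-1)) *: pauliX R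
                      - (2^-1 * (b + b^-1)) *: pauliZ R.
Proof.
rewrite /trigeval cross_sum /pencil_coef /z2char /=.
rewrite !expr0z !expr1z !exprN1 !mul1r !mulr1 scale1r !scalerN !scalerA.
have regroup (V : zmodType) (c x1 x2 z1 z2 : V) :
    c + (- z1 + (- z2 + (- x1 - x2))) = c - (x1 + x2) - (z1 + z2).
  by rewrite [- z1 + _]addrA -!opprD [z1 + z2 + _]addrC opprD addrA.
by rewrite regroup -!scalerDl [2^-1 * (a + _)]mulrC [2^-1 * (b + _)]mulrC.
Qed.

End Witness.

Lemma sign_unimodular (R : realType) (a : R[i]) : a ^+ 2 = 1 -> a^* * a = 1.
Proof.
move/eqP; rewrite sqrf_eq1 => /orP[] /eqP ->;
  by rewrite ?rmorphN rmorph1 ?mulrNN mulr1.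
Qed.

Lemma sign_real_part (R : realType) (a : R[i]) :
  a ^+ 2 = 1 -> 2^-1 * (a + a^-1) = a.
Proof.
move=> a2; have a0 : a != 0 by rewrite -sqrf_eq0 a2 oner_eq0.
have -> : a^-1 = a by apply: (mulfI a0); rewrite mulfV // -expr2.
by rewrite -mulr2n -[a *+ 2]mulr_natl mulKf // pnatr_eq0.
Qed.

(** On a row, the character factors as b^n with n fixed, times a function of a.
    The factor b^n has modulus 1 and cancels in the square; columns are treated
    in the same way. *)
Lemma pauli_functional_gram_ge0 (R : realType) (S : {fset Z2})
    (N : Z2 -> 'M[R[i]]_2) :
  (forall s t, s \in S -> t \in S -> cross (s * t^-1)%g) ->
  0 <= pauli_functional
         (fun a b => trigeval a b S N *m adjmx (trigeval a b S N)).
Proof.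
have sgn := @sign_unimodular R.
have gram (n : nat) (k : R[i]) (M : 'M[R[i]]_n) : k^* * k = 1 ->
    (k *: M) *m adjmx (k *: M) = M *m adjmx M.
  move=> kk; have -> : adjmx (k *: M) = k^* *: adjmx M.
    by apply/matrixP => i j; rewrite !mxE rmorphM.
  by rewrite -scalemxAl -scalemxAr scalerA mulrC kk scale1r.
have [->|[s0 s0S]] := fset_0Vmem S.
  move=> _; apply: (@pauli_functional_row_ge0 _ _ (fun=> 0)) => a b _ _.
  by rewrite /trigeval big_seq_fset0 !mul0mx.
case/cross_difference_line => line.
  apply: (@pauli_functional_row_ge0 _ _
            (fun a => \sum_(s <- S) a ^ s.1 *: N s)).
  move=> a b ha hb; rewrite -[RHS](gram _ (b ^ s0.2)) ?unimodularX ?sgn //.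
  suff -> : trigeval a b S N = b ^ s0.2 *: \sum_(s <- S) a ^ s.1 *: N s by [].
  rewrite scaler_sumr [LHS]big_seq [RHS]big_seq; apply: eq_bigr => s sS.
  by rewrite scalerA /z2char (line s s0) // mulrC.
apply: (@pauli_functional_col_ge0 _ _ (fun b => \sum_(s <- S) b ^ s.2 *: N s)).
move=> a b ha hb; rewrite -[RHS](gram _ (a ^ s0.1)) ?unimodularX ?sgn //.
suff -> : trigeval a b S N = a ^ s0.1 *: \sum_(s <- S) b ^ s.2 *: N s by [].
rewrite scaler_sumr [LHS]big_seq [RHS]big_seq; apply: eq_bigr => s sS.
by rewrite scalerA /z2char (line s s0).
Qed.

Theorem corollary5p9 (R : realType) (A : cstarAlgType R) (delta : Z2 -> A)
    (hA : universal_group_cstar delta) :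
  positivity_domain cross /\ ~ complete_factorisation delta cross.
Proof.
split; first exact: cross_positivity_domain.
have rep := hA.1; have dM := rep.1; have dU := rep.2.
have pos : mxpositive (trigsum delta (seq_fset tt cross_seq) (pencil_coef R)).
  rewrite trigsum_pencil //; apply: pauli_pencil_positive.
  - by case: (dU ((1, 0) : Z2)).
  - by case: (dU ((1, 0) : Z2)).
  - by case: (dU ((0, 1) : Z2)).
  - by case: (dU ((0, 1) : Z2)).
  - by rewrite /GRing.comm -!dM.
  - lra.
  - lra.
move=> fact.
have [||r [S [N [hS heq]]]] := fact _ _ pos _ (4^-1 : R).
- exists (seq_fset tt cross_seq), (pencil_coef R); split=> // s.
  by rewrite seq_fsetE.
- by rewrite invr_gt0 ltr0n.
have ev := factorisation_eval hA heq.
pose F i a b := trigeval a b (S i) (N i) *m adjmx (trigeval a b (S i) (N i)).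
have sum_ge0 : 0 <= pauli_functional (fun a b => \sum_i F i a b).
  rewrite pauli_functional_sum; apply: sumr_ge0 => i _.
  exact: pauli_functional_gram_ge0 (hS i).
pose d : R[i] := (3 / 2 : R)%:C + (4^-1 : R)%:C.
have eF a b : a ^+ 2 = 1 -> b ^+ 2 = 1 ->
    \sum_i F i a b = d%:M - a *: pauliX R - b *: pauliZ R.
  move=> ha hb.
  rewrite -ev ?sign_unimodular // trigeval_pencil !sign_real_part //.
  have regroup (V : zmodType) (c e x z : V) : c - x - z + e = c + e - x - z.
    by rewrite addrAC [c - x + e]addrAC.
  by rewrite raddfD; apply: regroup.
have val : pauli_functional (fun a b => \sum_i F i a b) = 4 * d - 8.
  by rewrite -pauli_functional_pencil; apply: pauli_functional_eq.
have natC k : k%:R = (k%:R : R)%:C by rewrite rmorph_nat.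
move: sum_ge0; rewrite val /d !natC -!rmorphD -rmorphM -rmorphB /= ler0c; lra.
Qed.
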